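(* Let $(X,q)$ be an $f$-complete $\delta$-symmetric quasi-metric space, and let $T:X\to X$ be an $f$-Proinov-type $\mathcal{Z}$-contraction with respect to $\xi\in\mathcal{Z}$, with control functions $\zeta,\eta$. Suppose that: (i) $\zeta$ is nondecreasing; (ii) $\eta(t)<\zeta(t)$ for every $t\in \mathrm{Im}(q)\setminus\{0\}$; (iii) if $\{x_n\}$ and $\{y_n\}$ are two sequences in $(0,\infty)$ such that $\lim_{n\to\infty}x_n=\lim_{n\to\infty}y_n>0$, then $\lim_{n\to\infty}\zeta(x_n)=\lim_{n\to\infty}\zeta(y_n)>0$. Then $T$ has a unique fixed point in $X$. Moreover, for any $x\in X$ the iterative sequence $\{T^nx\}$ $f$-converges to the fixed point.
   Context: A quasi-metric on a nonempty set $X$ is a function $q:X\times X\to\mathbb{R}$ such that for all $x,y,z\in X$: $q(x,y)\ge 0$; $q(x,y)=0$ if and only if $x=y$; $q(x,y)\le q(x,z)+q(z,y)$. The space $(X,q)$ is $\delta$-symmetric if there exists $\delta>0$ with $q(x,y)\le\delta q(y,x)$ for all $x,y\in X$. $\mathrm{Im}(q)$ denotes the range of $q$. A sequence $\{a_n\}$ $f$-converges to $a\in X$ if $q(a,a_n)\to 0$. A sequence $\{a_n\}$ is $f$-Cauchy if for every $\epsilon>0$ there is $N$ such that $q(a_m,a_n)<\epsilon$ for all $n\ge m\ge N$; $(X,q)$ is $f$-complete if every $f$-Cauchy sequence $f$-converges to a point of $X$. A simulation function is a map $\xi:[0,\infty)\times[0,\infty)\to\mathbb{R}$ such that: ($z_1$)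 $\xi(0,0)=0$; ($z_2$) $\xi(s,t)<t-s$ for all $s,t>0$; ($z_3$) for any sequences $\{s_n\},\{t_n\}$ in $(0,\infty)$ with $\lim_{n\to\infty}s_n=\lim_{n\to\infty}t_n>0$ one has $\limsup_{n\to\infty}\xi(s_n,t_n)<0$. $\mathcal{Z}$ is the set of all simulation functions. A map $T:X\to X$ is an $f$-Proinov-type $\mathcal{Z}$-contraction with respect to $\xi\in\mathcal{Z}$ if $\xi\big(\zeta(q(Tx,Ty)),\eta(q(x,y))\big)\ge 0$ for all $x,y\in X$, where $\zeta,\eta:(0,\infty)\to\mathbb{R}$ are two control functions with $\eta(t)<\zeta(t)$ for all $t\in\mathrm{Im}(q)\setminus\{0\}$.
   Formalization: The contraction inequality is required only for x, y with Tx ≠ Ty, and there it is additionally assumed that ζ(q(Tx,Ty)) ≥ 0 and η(q(x,y)) > 0; if η may vanish the claim fails (swap of two points, ζ=1, η=0, ξ(s,0)=1 for s>0). *)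

(* Defs.v *)
From HB Require Import structures.
From mathcomp Require Import all_boot all_order all_algebra.
From mathcomp Require Import all_classical all_reals all_analysis.

Set Implicit Arguments.
Unset Strict Implicit.
Unset Printing Implicit Defensive.

Import Order.TTheory GRing.Theory Num.Theory.
Import numFieldNormedType.Exports.

Local Open Scope classical_set_scope.
Local Open Scope ring_scope.

(* Functions on [0, oo) or (0, oo) are total functions on R about which nothing
   is assumed or used outside of their domain. *)

Definition quasi_metric (R : realType) (X : Type) (q : X -> X -> R) : Prop :=
  [/\ forall x y, 0 <= q x y,
      forall x y, q x y = 0 <-> x = y
    & forall x y z, q x y <= q x z + q z y].

Definition delta_symmetric (R : realType) (X : Type) (q : X -> X -> R) : Prop :=
  exists2 delta : R, 0 < delta & forall x y, q x y <= delta * q y x.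

Definition range2 (R : realType) (X : Type) (q : X -> X -> R) : set R :=
  [set t | exists x y, q x y = t].

Definition f_converges (R : realType) (X : Type) (q : X -> X -> R)
    (u : nat -> X) (a : X) : Prop :=
  (fun n => q a (u n)) @ \oo --> (0 : R).

Definition f_cauchy (R : realType) (X : Type) (q : X -> X -> R)
    (u : nat -> X) : Prop :=
  forall eps : R, 0 < eps -> exists N : nat,
    forall m n : nat, (N <= m)%N -> (m <= n)%N -> q (u m) (u n) < eps.

Definition f_complete (R : realType) (X : Type) (q : X -> X -> R) : Prop :=
  forall u : nat -> X, f_cauchy q u -> exists a, f_converges q u a.

(* The limsup is taken in the extended reals, since xi (s n) (t n) need not be
   bounded below. *)
Definition simulation_function (R : realType) (xi : R -> R -> R) : Prop :=
  [/\ xi 0 0 = 0,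
      forall s t : R, 0 < s -> 0 < t -> xi s t < t - s
    & forall (s t : nat -> R) (l : R),
        (forall n, 0 < s n) -> (forall n, 0 < t n) -> 0 < l ->
        s @ \oo --> l -> t @ \oo --> l ->
        (limn_esup (fun n => (xi (s n) (t n))%:E) < 0%:E)%E].

(* The inequality xi (zeta (q (T x) (T y))) (eta (q x y)) >= 0 is meaningful
   only where zeta is evaluated in (0, oo), hence the guard (which also forces
   0 < q x y), and only if xi is evaluated in its domain, hence the conditions
   on the signs.  The second argument has to be nonzero: xi s 0 is unconstrained
   for s > 0 in a simulation function, so with eta = 0 the inequality would say
   nothing about T. *)
Definition f_proinov_Z_contraction (R : realType) (X : Type) (q : X -> X -> R)
    (xi : R -> R -> R) (zeta eta : R -> R) (T : X -> X) : Prop :=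
  (forall t, (range2 q `\ 0) t -> eta t < zeta t) /\
  (forall x y, 0 < q (T x) (T y) ->
     [/\ 0 <= zeta (q (T x) (T y)),
         0 < eta (q x y)
       & 0 <= xi (zeta (q (T x) (T y))) (eta (q x y))]).

(* Main.v *)
Require Import Defs.
From mathcomp Require Import all_boot all_order all_algebra.
From mathcomp Require Import all_classical all_reals all_analysis.

Import Order.TTheory GRing.Theory Num.Theory.
Import numFieldNormedType.Exports.

Local Open Scope classical_set_scope.
Local Open Scope ring_scope.

(** The contraction hypothesis is reduced to a Meir-Keeler condition: for every
    [e > 0] there is [h > 0] such that [q x y < e + h] forces
    [q (T x) (T y) < e].

    If [q (T x) (T y) > 0], nonnegativity of [xi] together with
    [xi s t < t - s] gives
    [zeta (q (T x) (T y)) < eta (q x y) < zeta (q x y)]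
    ([proinov_sandwich]), so monotonicity of [zeta] gives
    [q (T x) (T y) < q x y].  The hypothesis on limits, read on constant
    sequences, makes [zeta] positive on [(0, oo)].  If the Meir-Keeler condition
    failed at [e], there would be pairs [(x_n, y_n)] for which both [q x_n y_n]
    and [q (T x_n) (T y_n)] lie in [[e, e + 1 / (n + 1))].  Then [zeta] of both
    sequences tends to the same [L > 0], hence so does [eta (q x_n y_n)] by the
    sandwich, and [(z_3)] makes the limsup of a nonnegative sequence negative
    ([proinov_meir_keeler]).

    A Meir-Keeler map on a quasi-metric space has f-Cauchy orbits: the steps
    [q x_n x_(n+1)] decrease to an infimum that cannot be positive
    ([orbit_step_small]), and once they are smaller than [h] the bound
    [q x_m x_n < e + h] propagates from [n] to [n + 1], because applying [T]
    brings the distance below [e] and prepending one step adds less than [h]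
    ([orbit_f_cauchy]).  By completeness the orbit f-converges to some [u];
    as [T] is nonexpansive it also f-converges to [T u], and delta-symmetry
    makes f-limits unique, so [T u = u].  Two distinct fixed points would
    contradict strict contractivity. *)

(** * Quasi-metric spaces *)

Lemma f_convergesP {R : realType} {X : Type} (q : X -> X -> R) (u : nat -> X)
    (a : X) : quasi_metric q ->
  f_converges q u a <->
  (forall e, 0 < e -> exists N, forall n, (N <= n)%N -> q a (u n) < e).
Proof.
move=> [q0 _ _]; split=> [/cvgr0Pnorm_lt cu e e0|cu].
  have [N _ NP] := cu e e0; exists N => n Nn.
  by have := NP n Nn; rewrite /= ger0_norm.
apply/cvgr0Pnorm_lt => e e0; have [N NP] := cu e e0.
by exists N => // n /= Nn; rewrite ger0_norm //; exact: NP.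
Qed.

Lemma quasi_metric_neq0 {R : realType} {X : Type} (q : X -> X -> R) (x y : X) :
  quasi_metric q -> x <> y -> 0 < q x y.
Proof.
move=> [q0 qE _] xy; rewrite lt_neqAle q0 andbT eq_sym.
by apply/eqP => /qE.
Qed.

(** Both limits put the terms on the right of [q]; symmetry up to [delta] is
    what allows the triangle inequality to pass through the sequence. *)
Lemma f_limit_unique {R : realType} {X : Type} (q : X -> X -> R)
    (u : nat -> X) (a b : X) : quasi_metric q -> delta_symmetric q ->
  f_converges q u a -> f_converges q u b -> a = b.
Proof.
move=> qq [d d0 qd] /(f_convergesP _ _ _ qq) ua /(f_convergesP _ _ _ qq) ub.
have [// | ab] := pselect (a = b); exfalso.
have ab0 := quasi_metric_neq0 q a b qq ab; case: (qq) => _ _ tri.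
have e0 : 0 < q a b / 2 by rewrite divr_gt0.
have [N NP] := ua _ e0.
have [M MP] := ub (q a b / 2 / d) (divr_gt0 e0 d0).
set n := maxn N M.
have := NP n (leq_maxl _ _); have := MP n (leq_maxr _ _).
rewrite ltr_pdivlMr // mulrC => h2 h1.
suff : q a b < q a b by rewrite ltxx.
rewrite {2}[q a b]splitr; apply: le_lt_trans (tri a b (u n)) _.
by apply: ltrD h1 _; exact: le_lt_trans (qd _ _) h2.
Qed.

(** * Meir-Keeler maps *)

Definition meir_keeler {R : realType} {X : Type} (q : X -> X -> R)
    (T : X -> X) : Prop :=
  forall e, 0 < e -> exists2 h, 0 < h &
    forall x y, q x y < e + h -> q (T x) (T y) < e.

(** The Meir-Keeler condition at [e := q x y]. *)
Lemma meir_keeler_contractive {R : realType} {X : Type} (q : X -> X -> R)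
    (T : X -> X) (x y : X) : quasi_metric q -> meir_keeler q T ->
  x <> y -> q (T x) (T y) < q x y.
Proof.
move=> qq mk xy; have [h h0] := mk _ (quasi_metric_neq0 q x y qq xy).
by apply; rewrite ltrDl.
Qed.

Lemma meir_keeler_nonexpansive {R : realType} {X : Type} (q : X -> X -> R)
    (T : X -> X) (x y : X) : quasi_metric q -> meir_keeler q T ->
  q (T x) (T y) <= q x y.
Proof.
move=> qq mk; have [->|xy] := pselect (x = y).
  by case: qq => _ qE _; rewrite (qE _ _).2 // (qE _ _).2.
by apply: ltW; exact: (meir_keeler_contractive q T).
Qed.

(** If the infimum [l] of the steps were positive, some step would lie below
    [l + h] and the following one below [l]. *)
Lemma orbit_step_small {R : realType} {X : Type} (q : X -> X -> R)
    (T : X -> X) (x : X) (e : R) : quasi_metric q -> meir_keeler q T ->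
  0 < e ->
  exists N, forall n, (N <= n)%N -> q (iter n T x) (iter n.+1 T x) < e.
Proof.
move=> qq mk e0; pose d n := q (iter n T x) (iter n.+1 T x).
case: (qq) => q0 _ _.
have d_ninc n m : (n <= m)%N -> d m <= d n.
  elim: m => [|m IH]; first by rewrite leqn0 => /eqP ->.
  rewrite leq_eqVlt => /predU1P[-> //|]; rewrite ltnS => /IH.
  by apply: le_trans; exact: (meir_keeler_nonexpansive q T).
have dlb : has_lbound (range d) by exists 0 => _ [n _ <-]; exact: q0.
have dinf : has_inf (range d) by split => //; exists (d 0%N), 0%N.
have [l0|l0] := ltP 0 (inf (range d)).
  have [h h0 hP] := mk _ l0.
  have [_ [n _ <-] /hP dn] := inf_adherent h0 dinf.
  have : inf (range d) <= d n.+1 by apply: ge_inf => //; exists n.+1.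
  by move=> /le_lt_trans /(_ dn); rewrite ltxx.
have [_ [N _ <-] dN] := inf_adherent e0 dinf.
exists N => n /d_ninc /le_lt_trans; apply; apply: lt_le_trans dN _.
by rewrite gerDr.
Qed.

(** The invariant [q x_m x_n < e + h] of the induction is strictly weaker than
    the bound [e] that one application of [T] restores; the slack [h] is spent
    on the first step of the orbit. *)
Lemma orbit_f_cauchy {R : realType} {X : Type} (q : X -> X -> R)
    (T : X -> X) (x : X) : quasi_metric q -> meir_keeler q T ->
  f_cauchy q (fun n => iter n T x).
Proof.
move=> qq mk e e0; have [h h0 hP] := mk e e0.
have [N NP] := orbit_step_small q T x h qq mk h0.
case: (qq) => _ qE tri.
have tail m k : (N <= m)%N -> q (iter m T x) (iter (m + k) T x) < e + h.
  move=> Nm; elim: k => [|k IH].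
    by rewrite addn0 (qE _ _).2 // addr_gt0.
  rewrite addnS; apply: le_lt_trans (tri _ _ (iter m.+1 T x)) _.
  by rewrite addrC; apply: ltrD (hP _ _ IH) (NP _ Nm).
(* The start is shifted by one so that a last application of [T] trades the
   bound [e + h] for [e]. *)
exists N.+1 => -[//|m] [//|n]; rewrite !ltnS => Nm /subnKC <-.
exact/hP/tail.
Qed.

Lemma meir_keeler_fixed_point {R : realType} {X : Type} (q : X -> X -> R)
    (T : X -> X) (x : X) : quasi_metric q -> delta_symmetric q ->
  f_complete q -> meir_keeler q T ->
  exists2 u, T u = u & f_converges q (fun n => iter n T x) u.
Proof.
move=> qq qd qc mk.
have [u xu] := qc _ (orbit_f_cauchy q T x qq mk).
exists u => //; apply: (f_limit_unique q _ _ _ qq qd _ xu).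
move/(f_convergesP _ _ _ qq) in xu; apply/(f_convergesP _ _ _ qq) => e /xu[N NP].
exists N.+1 => -[//|n]; rewrite ltnS => /NP; apply: le_lt_trans.
exact: (meir_keeler_nonexpansive q T).
Qed.

Lemma meir_keeler_fixed_point_unique {R : realType} {X : Type}
    (q : X -> X -> R) (T : X -> X) (u v : X) : quasi_metric q ->
  meir_keeler q T -> T u = u -> T v = v -> u = v.
Proof.
move=> qq mk Tu Tv; have [// | uv] := pselect (u = v); exfalso.
by have := meir_keeler_contractive q T u v qq mk uv; rewrite Tu Tv ltxx.
Qed.

(** * Proinov-type contractions *)

(** A nonnegative sequence with nonpositive limsup tends to [0], so its limsup
    is [0] and not negative as [(z_3)] demands. *)
Lemma simulation_function_common_limit {R : realType} (xi : R -> R -> R)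
    (s t : nat -> R) (l : R) : simulation_function xi ->
  (forall n, 0 < s n) -> (forall n, 0 < t n) -> 0 < l ->
  s @ \oo --> l -> t @ \oo --> l -> ~ (forall n, 0 <= xi (s n) (t n)).
Proof.
move=> [_ _ z3] s0 t0 l0 sl tl xi0; have lim_lt0 := z3 s t l s0 t0 l0 sl tl.
have cvg0 := limn_esup_le_cvg (ltW lim_lt0) xi0.
by move: lim_lt0; rewrite (cvg_limn_einf_sup cvg0).2 ltxx.
Qed.

Lemma proinov_sandwich {R : realType} {X : Type} (q : X -> X -> R)
    (xi : R -> R -> R) (zeta eta : R -> R) (T : X -> X) (x y : X) :
  quasi_metric q -> simulation_function xi ->
  f_proinov_Z_contraction q xi zeta eta T ->
  (forall t, 0 < t -> 0 < zeta t) -> 0 < q (T x) (T y) ->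
  zeta (q (T x) (T y)) < eta (q x y) < zeta (q x y).
Proof.
move=> [_ qE _] [_ z2 _] [ez con] zeta0 Txy.
have [_ eta0 xi0] := con x y Txy.
have := le_lt_trans xi0 (z2 _ _ (zeta0 _ Txy) eta0); rewrite subr_gt0 => -> /=.
apply: ez; split; first by exists x, y.
by move=> /= /qE xy; move: Txy; rewrite xy (qE _ _).2 ?ltxx.
Qed.

Lemma proinov_meir_keeler {R : realType} {X : Type} (q : X -> X -> R)
    (xi : R -> R -> R) (zeta eta : R -> R) (T : X -> X) :
  quasi_metric q -> simulation_function xi ->
  f_proinov_Z_contraction q xi zeta eta T ->
  (forall s t : R, 0 < s -> s <= t -> zeta s <= zeta t) ->
  (forall (x y : nat -> R) (l : R),
     (forall n, 0 < x n) -> (forall n, 0 < y n) -> 0 < l ->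
     x @ \oo --> l -> y @ \oo --> l ->
     exists2 L : R, 0 < L &
       (zeta \o x) @ \oo --> L /\ (zeta \o y) @ \oo --> L) ->
  meir_keeler q T.
Proof.
move=> qq sxi con zeta_mono zeta_lim.
have zeta0 t : 0 < t -> 0 < zeta t.
  move=> t0; have [||||| L L0 [zL _]] := zeta_lim (cst t) (cst t) t => //.
  - exact: cvg_cst.
  - exact: cvg_cst.
  have -> // : zeta t = L.
  exact: (norm_cvg_unique (cvg_cst (zeta t)) zL).
move=> e e0; apply: contrapT => nmk.
have bad n : exists p : X * X,
    q p.1 p.2 < e + harmonic n /\ e <= q (T p.1) (T p.2).
  apply: contrapT => nbad; apply: nmk; exists (harmonic n) => //.
    by rewrite /harmonic/= invr_gt0.
  move=> x y xy; rewrite ltNge; apply/negP => Txy.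
  by apply: nbad; exists (x, y).
have [p pP] := choice bad.
pose s n := q (T (p n).1) (T (p n).2); pose t n := q (p n).1 (p n).2.
have es n : e <= s n by case: (pP n).
have s0 n : 0 < s n := lt_le_trans e0 (es n).
have sw n : zeta (s n) < eta (t n) < zeta (t n).
  exact: (proinov_sandwich q xi zeta eta T) (s0 n).
(* If [t n < s n], then [t n > 0] (otherwise both distances vanish) and
   monotonicity contradicts the sandwich. *)
have st n : s n <= t n.
  have [//|ts] := leP (s n) (t n); exfalso.
  have t0 : 0 < t n.
    apply: (quasi_metric_neq0 q) => // pE; move: (s0 n).
    by case: qq => _ qE _; rewrite /s pE (qE _ _).2 ?ltxx.
  have /andP[h1 h2] := sw n.
  by have := lt_le_trans (lt_trans h1 h2) (zeta_mono _ _ t0 (ltW ts)); rewrite ltxx.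
have t0 n : 0 < t n := lt_le_trans (s0 n) (st n).
have te n : t n <= e + harmonic n by case: (pP n) => /ltW.
have eh : (fun n => e + harmonic n) @ \oo --> e.
  by rewrite -[X in _ --> X]addr0; apply: cvgD; [exact: cvg_cst|exact: cvg_harmonic].
have tl : t @ \oo --> e.
  apply: squeeze_cvgr (cvg_cst e) eh; apply: nearW => n.
  by rewrite te andbT (le_trans (es n)).
have sl : s @ \oo --> e.
  by apply: squeeze_cvgr (cvg_cst e) tl; apply: nearW => n; rewrite es st.
have [L L0 [zs zt]] := zeta_lim s t e s0 t0 e0 sl tl.
have et : (eta \o t) @ \oo --> L.
  apply: squeeze_cvgr zs zt; apply: nearW => n /=.
  by have /andP[/ltW -> /ltW ->] := sw n.
apply: (simulation_function_common_limit xi (zeta \o s) (eta \o t) L) => //.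
- by move=> n; exact: zeta0.
- by move=> n; have /andP[+ _] := sw n; apply: lt_trans; exact: zeta0.
- by move=> n; case: con => _ /(_ _ _ (s0 n))[].
Qed.

Theorem theorem3p1 (R : realType) (X : Type) (q : X -> X -> R)
    (T : X -> X) (xi : R -> R -> R) (zeta eta : R -> R)
    (X_nonempty : [set: X] !=set0)
    (q_quasi_metric : quasi_metric q)
    (q_delta_symmetric : delta_symmetric q)
    (q_f_complete : f_complete q)
    (xi_simulation : simulation_function xi)
    (T_contraction : f_proinov_Z_contraction q xi zeta eta T)
    (zeta_nondecreasing : forall s t : R, 0 < s -> s <= t -> zeta s <= zeta t)
    (eta_lt_zeta : forall t, (range2 q `\ 0) t -> eta t < zeta t)
    (zeta_lim : forall (x y : nat -> R) (l : R),
       (forall n, 0 < x n) -> (forall n, 0 < y n) -> 0 < l ->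
       x @ \oo --> l -> y @ \oo --> l ->
       exists2 L : R, 0 < L &
         (zeta \o x) @ \oo --> L /\ (zeta \o y) @ \oo --> L) :
  (exists! u, T u = u) /\
  (forall u, T u = u ->
     forall x, f_converges q (fun n => iter n T x) u).
Proof.
have mk : meir_keeler q T.
  exact: (proinov_meir_keeler q xi zeta eta).
have fix_unique u v : T u = u -> T v = v -> u = v.
  exact: (meir_keeler_fixed_point_unique q).
have fixP x := meir_keeler_fixed_point q T x q_quasi_metric q_delta_symmetric
  q_f_complete mk.
split.
  have [x _] := X_nonempty; have [u Tu _] := fixP x.
  by exists u; split => // v; exact: fix_unique.
by move=> u Tu x; have [v Tv] := fixP x; rewrite (fix_unique _ _ Tv Tu).
Qed.
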